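(* Let $D\ge 1$ and let $\mathcal{A}^D_{\hbar,q}(\mathcal{F})$ be a shift algebra such that $\mathcal{F}$ separates points of $\mathbb{R}^D$. Let $R,\tilde R\in\mathrm{Mat}_D(\mathbb{Z})$ have nonzero determinant and let $\delta,\tilde\delta\in\mathbb{R}^D$. Then $\mathcal{S}_\hbar(R,\delta)\simeq\mathcal{S}_\hbar(\tilde R,\tilde\delta)$ as left $\mathcal{A}^D_{\hbar,q}(\mathcal{F})$-modules if and only if there exist $U\in\mathrm{GL}_D(\mathbb{Z})$ and $n\in\mathbb{Z}^D$ such that $\tilde R=UR$ and $\tilde\delta=\delta+R^{-1}n$.
   Context: $F(\mathbb{R}^D,\mathbb{C})$ is the $\ast$-algebra of all complex valued functions on $\mathbb{R}^D$ (involution = complex conjugation). For $\hbar>0$, $k\in\mathbb{Z}^D$ put $(S_\hbar^k f)(u)=f(u+k\hbar)$. A $\ast$-subalgebra $\mathcal{F}\subseteq F(\mathbb{R}^D,\mathbb{C})$ is $\hbar$-invariant if $S_\hbar^kf\in\mathcal{F}$ for all $f\in\mathcal{F}$, $k\in\mathbb{Z}^D$; it separates points if for any distinct $x,y\in\mathbb{R}^D$ there is $f\in\mathcal{F}$ with $f(x)\ne f(y)$. For $k,l\in\mathbb{R}^D$ let $N(k,l)=\sum_{m=2}^D\sum_{n=1}^{m-1}k_ml_n$ (and $N=0$ if $D=1$). For $q\in\mathbb{C}$, $|q|=1$, a real $\theta$ with $q=e^{i\theta}$ is fixed and $q^t=e^{i\theta t}$ for $t\in\mathbb{R}$. Shift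 algebra: for $\hbar>0$, $|q|=1$ and $\mathcal{F}$ an $\hbar$-invariant $\ast$-subalgebra of $F(\mathbb{R}^D,\mathbb{C})$, $\mathcal{A}^D_{\hbar,q}(\mathcal{F})$ consists of finite formal sums $\sum_{k\in\mathbb{Z}^D}f_kU^k$ (here $U^k$ are formal symbols), $f_k\in\mathcal{F}$, with product $(\sum_kf_kU^k)(\sum_lg_lU^l)=\sum_{k,l}q^{N(k,l)}f_k(S_\hbar^kg_l)U^{k+l}$. Modules: for $R\in\mathrm{Mat}_D(\mathbb{Z})$ with $\det R\neq0$ and $\delta\in\mathbb{R}^D$, $\mathcal{S}_\hbar(R,\delta)$ is the space of finitely supported functions $\xi:\mathbb{Z}^D\to\mathbb{C}$ with the left action $(f\xi)(k)=\sum_{n\in\mathbb{Z}^D}q^{N(R^{-1}k+\delta,n)}f_n\big((R^{-1}k+\delta)\hbar\big)\xi(k+Rn)$ for $f=\sum_nf_nU^n$. *)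

(* Defs.v *)
From HB Require Import structures.
From mathcomp Require Import all_boot all_order all_algebra.
From mathcomp Require Import finmap complex.
From mathcomp Require Import all_classical reals trigo.

Set Implicit Arguments.
Unset Strict Implicit.
Unset Printing Implicit Defensive.

Import Order.TTheory GRing.Theory Num.Theory.

Local Open Scope classical_set_scope.
Local Open Scope ring_scope.
Local Open Scope complex_scope.

(* Associative algebras are not assumed to have a unit, and correspondingly
   left modules are not required to be unital. *)
Record nuAlgebra (K : pzRingType) := NuAlgebra {
  nua_sort :> lmodType K;
  nua_mul : nua_sort -> nua_sort -> nua_sort;
  nua_mulA : associative nua_mul;
  nua_mul_linearl : forall b, linear (nua_mul^~ b);
  nua_mul_linearr : forall a, linear (nua_mul a) }.

Record leftModule (K : pzRingType) (A : nuAlgebra K) := LeftModule {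
  lm_sort :> lmodType K;
  lm_act : A -> lm_sort -> lm_sort;
  lm_actM : forall a b x, lm_act (nua_mul a b) x = lm_act a (lm_act b x);
  lm_act_linearl : forall x, linear (lm_act^~ x);
  lm_act_linearr : forall a, linear (lm_act a) }.

Definition lm_isomorphic (K : pzRingType) (A : nuAlgebra K)
    (M N : leftModule A) : Prop :=
  exists phi : {linear M -> N},
    bijective phi /\ forall a x, phi (lm_act a x) = lm_act a (phi x).

Section FinSupp.
Variables (K : pzRingType) (I : choiceType) (V : lmodType K).

Definition finsupp_pred : {pred I -> V} :=
  fun f => `[< finite_set [set i | f i != 0] >].

Lemma finsuppP f : reflect (finite_set [set i | f i != 0]) (f \in finsupp_pred).
Proof. exact: asboolP. Qed.

Lemma finsupp_submod_closed : submod_closed finsupp_pred.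
Proof.
split=> [|a f g /finsuppP ff /finsuppP fg]; apply/finsuppP.
  by apply: (sub_finite_set _ (finite_set0 I)) => i /=; rewrite eqxx.
have : finite_set ([set i | f i != 0] `|` [set i | g i != 0]).
  by rewrite finite_setU.
apply: sub_finite_set => i /=; apply: contraNP => /not_orP[/negP + /negP].
rewrite !negbK => /eqP fi /eqP gi.
by rewrite !fctE fi gi scaler0 addr0.
Qed.

HB.instance Definition _ :=
  GRing.isSubmodClosed.Build K (I -> V) finsupp_pred finsupp_submod_closed.

Record finsupp := FinSupp {
  finsupp_fun :> I -> V;
  finsupp_finite : finsupp_fun \in finsupp_pred }.

HB.instance Definition _ := [isSub for finsupp_fun].
HB.instance Definition _ := [Choice of finsupp by <:].
HB.instance Definition _ := [SubChoice_isSubLmodule of finsupp by <:].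

Lemma finsuppE (a : K) (f g : finsupp) i : (a *: f + g) i = a *: f i + g i.
Proof. by []. Qed.

End FinSupp.

Section Shift.
Variables (R : realType) (D : nat).

(* R[i]^o is R[i] as a vector space over itself. *)
Local Notation cfun := ('cV[R]_D -> R[i]^o).

Definition vint (k : 'cV[int]_D) : 'cV[R]_D := map_mx intr k.

Definition rmx (B : 'M[int]_D) : 'M[R]_D := map_mx intr B.

Definition shift (hbar : R) (k : 'cV[int]_D) (f : cfun) : cfun :=
  fun u => f (u + hbar *: vint k).

Record starSubalgebra := StarSubalgebra {
  ssa_pred :> {pred cfun};
  ssa_submod : submod_closed ssa_pred;
  ssa_mul : forall f g : cfun,
    f \in ssa_pred -> g \in ssa_pred -> (fun u => f u * g u : R[i]^o) \in ssa_pred;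
  ssa_conj : forall f : cfun,
    f \in ssa_pred -> (fun u => (f u)^* : R[i]^o) \in ssa_pred }.

Definition hbar_invariant (hbar : R) (F : starSubalgebra) : Prop :=
  forall (f : cfun) (k : 'cV[int]_D), f \in F -> shift hbar k f \in F.

Definition separates_points (F : starSubalgebra) : Prop :=
  forall x y : 'cV[R]_D, x <> y -> exists f : cfun, f \in F /\ f x <> f y.

Definition pairN (k l : 'cV[R]_D) : R :=
  \sum_(m < D) \sum_(n < D | (n < m)%N) k m 0 * l n 0.

Definition expi (x : R) : R[i] := cos x +i* sin x.

(* q ^ t for q = expi theta *)
Definition qpow (theta t : R) : R[i] := expi (theta * t).

HB.instance Definition _ (F : starSubalgebra) :=
  GRing.isSubmodClosed.Build R[i] cfun (ssa_pred F) (ssa_submod F).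

Record ssa_type (F : starSubalgebra) := SsaElt {
  ssa_val :> cfun;
  ssa_valP : ssa_val \in ssa_pred F }.

HB.instance Definition _ F := [isSub for @ssa_val F].
HB.instance Definition _ F := [Choice of ssa_type F by <:].
HB.instance Definition _ F := [SubChoice_isSubLmodule of ssa_type F by <:].

Definition ssa_mulr F (f g : ssa_type F) : ssa_type F :=
  SsaElt (ssa_mul (ssa_valP f) (ssa_valP g)).

Definition ssa_shift hbar F (Finv : hbar_invariant hbar F) (k : 'cV[int]_D)
    (f : ssa_type F) : ssa_type F :=
  SsaElt (Finv f k (ssa_valP f)).

Lemma expiD x y : expi (x + y) = expi x * expi y.
Proof.
rewrite /expi cosD sinD; apply/eqP.
by rewrite eq_complex /= addrC !eqxx /= addrC eqxx.
Qed.

Lemma qpowD theta s t : qpow theta (s + t) = qpow theta s * qpow theta t.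
Proof. by rewrite /qpow mulrDr expiD. Qed.

Lemma pairNDl k k' l : pairN (k + k') l = pairN k l + pairN k' l.
Proof.
rewrite /pairN -big_split; apply: eq_bigr => m _ /=.
by rewrite -big_split; apply: eq_bigr => n _ /=; rewrite mxE mulrDl.
Qed.

Lemma pairNDr k l l' : pairN k (l + l') = pairN k l + pairN k l'.
Proof.
rewrite /pairN -big_split; apply: eq_bigr => m _ /=.
by rewrite -big_split; apply: eq_bigr => n _ /=; rewrite mxE mulrDr.
Qed.

Lemma vintD k l : vint (k + l) = vint k + vint l.
Proof. exact: map_mxD. Qed.

Section ShiftAlgebra.
Variables (hbar theta : R) (F : starSubalgebra) (Finv : hbar_invariant hbar F).

(* An element [f] stands for the formal sum of the [f k] U^k. *)
Local Notation shift_elt := (finsupp 'cV[int]_D (ssa_type F)).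

(* Coefficient of U^p in the product: the indices k, l with k + l = p are
   the pairs (k, p - k). *)
Definition shift_mul_fun (f g : shift_elt) (p : 'cV[int]_D) : ssa_type F :=
  \sum_(k \in [set: 'cV[int]_D])
    qpow theta (pairN (vint k) (vint (p - k))) *:
      ssa_mulr (f k) (ssa_shift Finv k (g (p - k))).

Definition supp (V : lmodType R[i]) (f : finsupp 'cV[int]_D V) :
  {fset 'cV[int]_D} := fset_set [set k | f k != 0].

Lemma supp_out (V : lmodType R[i]) (f : finsupp 'cV[int]_D V) k :
  k \notin supp f -> f k = 0.
Proof.
have /finsuppP fin := finsupp_finite f.
by rewrite in_fset_set// => /negP; rewrite inE /= => /negP/negPn/eqP.
Qed.

Lemma ssaE a (f g : ssa_type F) u : (a *: f + g) u = a * f u + g u.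
Proof. by []. Qed.

Lemma ssa_mul0l (g : ssa_type F) : ssa_mulr 0 g = 0.
Proof. by apply/val_inj/funext => u /=; exact: mul0r. Qed.

Lemma ssa_mul0r (g : ssa_type F) : ssa_mulr g 0 = 0.
Proof. by apply/val_inj/funext => u /=; exact: mulr0. Qed.

Lemma ssa_shift0 k : ssa_shift Finv k 0 = 0.
Proof. exact/val_inj/funext. Qed.

Lemma shift_mul_sum (f g : shift_elt) p (s : {fset 'cV[int]_D}) :
  (forall k, k \notin s -> f k = 0) ->
  shift_mul_fun f g p = \sum_(k <- s)
    qpow theta (pairN (vint k) (vint (p - k))) *:
      ssa_mulr (f k) (ssa_shift Finv k (g (p - k))).
Proof.
by move=> sf; apply: fsbigTE => k /sf ->; rewrite ssa_mul0l scaler0.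
Qed.

Lemma shift_mulE (f g : shift_elt) p u (s : {fset 'cV[int]_D}) :
  (forall k, k \notin s -> f k = 0) ->
  shift_mul_fun f g p u = \sum_(k <- s)
    qpow theta (pairN (vint k) (vint (p - k))) *
      (f k u * g (p - k) (u + hbar *: vint k)).
Proof.
by move=> sf; rewrite (shift_mul_sum _ _ sf) -[ssa_val _]/(val _) raddf_sum fct_sumE.
Qed.

Definition addfset (s t : {fset 'cV[int]_D}) : {fset 'cV[int]_D} :=
  [fset (x + y)%R | x in s, y in t]%fset.

Lemma mem_addfset (s t : {fset 'cV[int]_D}) x y :
  x \in s -> y \in t -> x + y \in addfset s t.
Proof. exact: in_imfset2. Qed.

Lemma shift_mul_supp (f g : shift_elt) p : p \notin addfset (supp f) (supp g) ->
  shift_mul_fun f g p = 0.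
Proof.
move=> pn; rewrite (shift_mul_sum _ _ (@supp_out _ f)).
rewrite big_seq big1// => k ks.
rewrite (@supp_out _ g) ?ssa_shift0 ?ssa_mul0r ?scaler0//.
by apply: contra pn => /(mem_addfset ks); rewrite addrC subrK.
Qed.

Lemma finsupp_fset (V : lmodType R[i]) (f : 'cV[int]_D -> V)
  (s : {fset 'cV[int]_D}) : (forall k, k \notin s -> f k = 0) ->
  f \in @finsupp_pred R[i] 'cV[int]_D V.
Proof.
move=> sf; apply/finsuppP; apply: (sub_finite_set _ (finite_fset s)) => k /=.
by apply: contraNT => /sf ->.
Qed.

Definition shift_mul (f g : shift_elt) : shift_elt :=
  FinSupp (finsupp_fset (@shift_mul_supp f g)).

Lemma shift_mul_linearl g : linear (shift_mul^~ g).
Proof.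
move=> a f f'; apply/val_inj/funext => p; apply/val_inj/funext => u.
set s := (supp f `|` supp f')%fset.
have sf k : k \notin s -> f k = 0.
  by rewrite in_fsetU negb_or => /andP[/supp_out].
have sf' k : k \notin s -> f' k = 0.
  by rewrite in_fsetU negb_or => /andP[_ /supp_out].
change (shift_mul_fun (a *: f + f') g p u =
  a * shift_mul_fun f g p u + shift_mul_fun f' g p u).
rewrite (@shift_mulE _ _ _ _ s); last first.
  by move=> k ks; rewrite finsuppE sf ?sf'// scaler0 addr0.
rewrite !(@shift_mulE _ _ _ _ s)// mulr_sumr -big_split.
apply: eq_bigr => k _.
by rewrite finsuppE ssaE mulrDl mulrDr -mulrA mulrCA.
Qed.

Lemma shift_mul_linearr f : linear (shift_mul f).
Proof.
move=> a g g'; apply/val_inj/funext => p; apply/val_inj/funext => u.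
change (shift_mul_fun f (a *: g + g') p u =
  a * shift_mul_fun f g p u + shift_mul_fun f g' p u).
rewrite !(shift_mulE _ _ _ (@supp_out _ f)) mulr_sumr -big_split.
apply: eq_bigr => k _.
rewrite finsuppE ssaE mulrDr mulrDr [f k u * (a * _)]mulrCA.
by congr (_ + _); exact: (@mulrCA R[i]).
Qed.

Lemma shift_mulA : associative shift_mul.
Proof.
move=> f g h; apply/val_inj/funext => p; apply/val_inj/funext => u.
rewrite /= (shift_mulE _ _ _ (@supp_out _ f)).
rewrite (@shift_mulE _ _ _ _ (addfset (supp f) (supp g))); last first.
  exact: shift_mul_supp.
pose G (k j : 'cV[int]_D) : R[i] :=
  qpow theta (pairN (vint k) (vint (p - k)) + pairN (vint j) (vint (k - j))) *
    (f j u * g (k - j) (u + hbar *: vint j) * h (p - k) (u + hbar *: vint k)).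
transitivity (\sum_(j <- supp f) \sum_(k <- addfset (supp f) (supp g)) G k j);
  last first.
  rewrite exchange_big /=; apply: eq_bigr => k _.
  rewrite (shift_mulE _ _ _ (@supp_out _ f)) mulr_suml mulr_sumr.
  by apply: eq_bigr => j _; rewrite /G qpowD !mulrA.
rewrite big_seq [RHS]big_seq; apply: eq_bigr => j js.
pose s := [fset (k - j)%R | k in addfset (supp f) (supp g)]%fset.
rewrite (@shift_mulE _ _ _ _ s); last first.
  move=> m ms; apply: supp_out; apply: contra ms => ms.
  have -> : m = j + m - j by rewrite [j + m]addrC addrK.
  exact: (in_imfset _ (fun k => k - j) (mem_addfset js ms)).
rewrite big_imfset /=; last by move=> x y _ _ /addIr.
rewrite !mulr_sumr; apply: eq_bigr => k _.
have e1 : p - j - (k - j) = p - k by rewrite opprB addrA subrK.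
have e2 : u + hbar *: vint j + hbar *: vint (k - j) = u + hbar *: vint k.
  by rewrite -addrA -scalerDr -vintD [j + _]addrC subrK.
rewrite e1 e2 /G.
have -> : pairN (vint k) (vint (p - k)) + pairN (vint j) (vint (k - j)) =
    pairN (vint j) (vint (p - j)) + pairN (vint (k - j)) (vint (p - k)).
  have -> : vint k = vint (k - j) + vint j by rewrite -vintD subrK.
  rewrite pairNDl -addrA addrC; congr (_ + _).
  by rewrite -pairNDr -vintD addrA subrK.
by by rewrite qpowD -!mulrA; congr (_ * _); rewrite mulrCA.
Qed.

Definition shift_algebra : nuAlgebra R[i] :=
  NuAlgebra shift_mulA shift_mul_linearl shift_mul_linearr.

Section ShiftModule.
Variables (A : 'M[int]_D) (detA : \det A != 0) (delta : 'cV[R]_D).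

Local Notation shift_mod_elt := (finsupp 'cV[int]_D R[i]^o).

Definition lattice_point (k : 'cV[int]_D) : 'cV[R]_D :=
  invmx (rmx A) *m vint k + delta.

Definition shift_act_fun (f : shift_algebra) (xi : shift_mod_elt)
    (k : 'cV[int]_D) : R[i]^o :=
  \sum_(n \in [set: 'cV[int]_D])
    qpow theta (pairN (lattice_point k) (vint n)) *
      (f : shift_elt) n (hbar *: lattice_point k) * xi (k + A *m n).

Lemma shift_actE (f : shift_elt) xi k (s : {fset 'cV[int]_D}) :
  (forall n, n \notin s -> f n = 0) ->
  shift_act_fun f xi k = \sum_(n <- s)
    qpow theta (pairN (lattice_point k) (vint n)) *
      f n (hbar *: lattice_point k) * xi (k + A *m n).
Proof.
move=> sf; apply: fsbigTE => k' /sf ->.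
by rewrite mulr0 mul0r.
Qed.

Definition actfset (s t : {fset 'cV[int]_D}) : {fset 'cV[int]_D} :=
  [fset (x - A *m n)%R | x in s, n in t]%fset.

Lemma mem_actfset (s t : {fset 'cV[int]_D}) x n :
  x \in s -> n \in t -> x - A *m n \in actfset s t.
Proof. by move=> xs nt; exact: in_imfset2. Qed.

Lemma shift_act_supp (f : shift_elt) xi k :
  k \notin actfset (supp xi) (supp f) ->
  shift_act_fun f xi k = 0.
Proof.
move=> kn; rewrite (shift_actE _ _ (@supp_out _ f)).
rewrite big_seq big1// => n ns.
rewrite (@supp_out _ xi) ?mulr0//.
apply: contra kn => ks; rewrite -[k](addrK (A *m n)).
exact: mem_actfset.
Qed.

Definition shift_act (f : shift_algebra) (xi : shift_mod_elt) : shift_mod_elt :=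
  FinSupp (finsupp_fset (@shift_act_supp f xi)).

Lemma shift_act_linearl xi : linear (shift_act^~ xi).
Proof.
move=> a f f'; apply/val_inj/funext => k.
set s := (supp (f : shift_elt) `|` supp (f' : shift_elt))%fset.
have sf n : n \notin s -> (f : shift_elt) n = 0.
  by rewrite in_fsetU negb_or => /andP[/supp_out].
have sf' n : n \notin s -> (f' : shift_elt) n = 0.
  by rewrite in_fsetU negb_or => /andP[_ /supp_out].
change (shift_act_fun (a *: f + f') xi k =
  a * shift_act_fun f xi k + shift_act_fun f' xi k).
rewrite (@shift_actE _ _ _ s); last first.
  by move=> n ns; rewrite finsuppE sf ?sf'// scaler0 addr0.
rewrite !(@shift_actE _ _ _ s)// mulr_sumr -big_split.
apply: eq_bigr => n _.
rewrite finsuppE ssaE mulrDr mulrDl; congr (_ + _).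
by rewrite [RHS]mulrA; congr (_ * _); exact: (@mulrCA R[i]).
Qed.

Lemma shift_act_linearr f : linear (shift_act f).
Proof.
move=> a x y; apply/val_inj/funext => k.
change (shift_act_fun f (a *: x + y) k =
  a * shift_act_fun f x k + shift_act_fun f y k).
rewrite !(shift_actE _ _ (@supp_out _ (f : shift_elt))) mulr_sumr -big_split.
apply: eq_bigr => n _.
rewrite finsuppE mulrDr; congr (_ + _); exact: (@mulrCA R[i]).
Qed.

Lemma rmx_unit : rmx A \in unitmx.
Proof. by rewrite unitmxE det_map_mx unitfE intr_eq0. Qed.

Lemma lattice_pointD k n :
  lattice_point (k + A *m n) = lattice_point k + vint n.
Proof.
rewrite /lattice_point vintD /vint map_mxM mulmxDr mulKmx ?rmx_unit//.
by rewrite addrAC.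
Qed.

Lemma shift_actM f g xi :
  shift_act (nua_mul f g) xi = shift_act f (shift_act g xi).
Proof.
move: f g => f g; apply/val_inj/funext => k /=.
set S := addfset (supp (f : shift_elt)) (supp (g : shift_elt)).
rewrite (@shift_actE _ _ _ S); last exact: shift_mul_supp.
rewrite (shift_actE _ _ (@supp_out _ (f : shift_elt))).
pose G (p n : 'cV[int]_D) : R[i] :=
  qpow theta (pairN (lattice_point k) (vint p) + pairN (vint n) (vint (p - n))) *
    ((f : shift_elt) n (hbar *: lattice_point k) *
     (g : shift_elt) (p - n) (hbar *: lattice_point k + hbar *: vint n) *
     xi (k + A *m p)).
transitivity (\sum_(n <- supp (f : shift_elt)) \sum_(p <- S) G p n).
  rewrite exchange_big /=; apply: eq_bigr => p _.
  rewrite (shift_mulE _ _ _ (@supp_out _ (f : shift_elt))) mulr_sumr mulr_suml.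
  by apply: eq_bigr => n _; rewrite /G qpowD !mulrA.
rewrite big_seq [RHS]big_seq; apply: eq_bigr => n ns.
pose s := [fset (p - n)%R | p in S]%fset.
rewrite -[shift_act g xi _]/(shift_act_fun g xi _).
rewrite (@shift_actE _ _ _ s); last first.
  move=> m ms; apply: supp_out; apply: contra ms => ms.
  have -> : m = n + m - n by rewrite [n + m]addrC addrK.
  exact: (in_imfset _ (fun k => k - n) (mem_addfset ns ms)).
rewrite big_imfset /=; last by move=> x y _ _ /addIr.
rewrite !mulr_sumr; apply: eq_bigr => p _.
have e1 : k + A *m n + A *m (p - n) = k + A *m p.
  by rewrite -addrA -mulmxDr [n + _]addrC subrK.
rewrite e1 lattice_pointD [hbar *: (lattice_point k + _)]scalerDr /G.
have -> : pairN (lattice_point k) (vint p) + pairN (vint n) (vint (p - n)) =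
    pairN (lattice_point k) (vint n) +
    pairN (lattice_point k + vint n) (vint (p - n)).
  by rewrite pairNDl addrA -pairNDr -vintD [n + _]addrC subrK.
by rewrite qpowD -!mulrA; congr (_ * _); rewrite mulrCA.
Qed.

Definition shift_module : leftModule shift_algebra :=
  LeftModule shift_actM shift_act_linearl shift_act_linearr.

End ShiftModule.
End ShiftAlgebra.
End Shift.

Arguments vint {R D} k.
Arguments rmx {R D} B.
Arguments shift_algebra {R D hbar} theta {F} Finv.
Arguments shift_module {R D hbar} theta {F} Finv A detA delta.

(* Main.v *)
(* [finmap] must precede [Defs], whose [finsupp] is the one meant below. *)
From mathcomp Require Import finmap.
Require Import Defs.
From HB Require Import structures.
From mathcomp Require Import all_boot all_order all_algebra.
From mathcomp Require Import complex.
From mathcomp Require Import all_classical reals trigo.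

Import Order.TTheory GRing.Theory Num.Theory.
Local Open Scope ring_scope.
Local Open Scope complex_scope.

(** The coefficient algebra [F], embedded as the elements [f U^0], acts
    diagonally: the basis vector at [k] has the character
    [f |-> f (hbar *: lattice_point A delta k)].  A module isomorphism preserves
    these characters, and since [F] separates points they determine the lattice
    points; hence isomorphic modules have the same affine lattice
    [A^-1 Z^D + delta].  Conversely, a bijection of indices that respects the
    lattice points intertwines the two actions. *)

Section ShiftModules.
Set Implicit Arguments.
Unset Strict Implicit.

(** Lets a one-sided inclusion of lattices be applied in both directions. *)
Lemma lm_isomorphic_sym (K : pzRingType) (B : nuAlgebra K)
    (M N : leftModule B) :
  lm_isomorphic M N -> lm_isomorphic N M.
Proof.
move=> [phi [[psi phiK psiK] phiA]].
have psi_lin : linear psi := can2_linear phiK psiK.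
pose psiL : {linear N -> M} :=
  HB.pack psi (GRing.isLinear.Build K N M *:%R psi psi_lin).
exists psiL; split; first by exists phi.
by move=> a y; apply: (can_inj phiK); rewrite phiA /= !psiK.
Qed.

Variables (R : realType) (D : nat).
Implicit Types (A U V : 'M[int]_D) (delta : 'cV[R]_D) (k l n : 'cV[int]_D).

Lemma map_intr_mx_inj m p :
  injective (map_mx intr : 'M[int]_(m, p) -> 'M[R]_(m, p)).
Proof.
move=> B C /matrixP e; apply/matrixP => i j; apply: (@intr_inj R).
by have := e i j; rewrite !mxE.
Qed.

Lemma vint_inj : injective (@vint R D).
Proof. exact: map_intr_mx_inj. Qed.

Lemma rmx_inj : injective (@rmx R D).
Proof. exact: map_intr_mx_inj. Qed.

Lemma lattice_point_inj A delta :
  \det A != 0 -> injective (lattice_point A delta).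
Proof.
move=> detA k l /addIr /(can_inj (mulKVmx (rmx_unit R detA))).
exact: vint_inj.
Qed.

Lemma lattice_point0 A delta : lattice_point A delta 0 = delta.
Proof. by rewrite /lattice_point /vint map_mx0 mulmx0 add0r. Qed.

(** Differences of lattice points cancel the offsets: if [n] and [c j] are the indices matching [0]
    and the [j]-th basis vector, then [A^-1 (c j - n)] is the [j]-th column of [A'^-1]. So the
    columns [c j - n] form [V]. *)
Lemma lattice_sub_factor A A' delta delta' :
  \det A != 0 -> \det A' != 0 ->
  (forall l, exists k, lattice_point A delta k = lattice_point A' delta' l) ->
  exists V, A = V *m A'.
Proof.
move=> detA detA' sub.
have [n nE] := sub 0; have [c cE] := choice (fun j => sub (delta_mx j 0)).
pose V : 'M[int]_D := \matrix_(i, j) (c j - n) i 0.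
exists V; apply: rmx_inj; rewrite /rmx map_mxM -!/(rmx _).
suff eV : invmx (rmx A') = invmx (rmx A) *m rmx V :> 'M[R]_D.
  rewrite -[LHS](mulmxKV (rmx_unit R detA')) eV mulmxA mulmxV ?mul1mx //.
  exact: rmx_unit.
have cV j : col j (rmx V) = vint (c j) - vint n :> 'cV[R]_D.
  by apply/colP => i; rewrite !mxE rmorphB.
apply/matrixP => i j.
suff /colP/(_ i) : col j (invmx (rmx A')) =
    col j (invmx (rmx A) *m rmx V) :> 'cV[R]_D.
  by rewrite mxE [RHS]mxE.
rewrite [RHS]colE -mulmxA -colE cV mulmxBr colE.
move: (cE j) nE; rewrite lattice_point0 /lattice_point /vint map_delta_mx.
by move=> cjE nE; apply: (addIr delta'); rewrite -cjE -nE [RHS]addrA subrK.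
Qed.

Section Action.
Variables (hbar theta : R) (F : starSubalgebra R D).
Variable Finv : hbar_invariant hbar F.

Definition fsingle (V : lmodType R[i]) k (v : V) : finsupp 'cV[int]_D V.
Proof.
apply: (@FinSupp _ _ _ (fun l => if l == k then v else 0)).
apply: (@finsupp_fset _ _ _ _ [fset k]%fset) => l.
by rewrite inE => /negPf ->.
Defined.

Lemma qpow0 : qpow theta 0 = 1.
Proof. by rewrite /qpow mulr0 /expi cos0 sin0. Qed.

Lemma pairN0r (x : 'cV[R]_D) : pairN x 0 = 0.
Proof. by apply: (addIr (pairN x 0)); rewrite -pairNDr !add0r. Qed.

(** Only the index [0] contributes: there the phase is [1] and [xi] is not translated. *)
Lemma shift_act_diag A delta (f : ssa_type F) xi k :
  @shift_act R D hbar theta F Finv A delta (fsingle 0 f) xi k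
    = f (hbar *: lattice_point A delta k) * xi k.
Proof.
rewrite /= (@shift_actE _ _ _ _ _ _ _ _ _ _ _ [fset 0]%fset); last first.
  by move=> n; rewrite inE /= => /negPf ->.
rewrite big_seq_fset1 /= eqxx /vint map_mx0 pairN0r qpow0 mul1r.
by rewrite mulmx0 addr0.
Qed.

Lemma isomorphic_lattice_sub A A' (detA : \det A != 0) (detA' : \det A' != 0)
    delta delta' : 0 < hbar -> separates_points F ->
  lm_isomorphic (shift_module theta Finv A detA delta)
                (shift_module theta Finv A' detA' delta') ->
  forall k, exists l, lattice_point A' delta' l = lattice_point A delta k.
Proof.
move=> hbar_gt0 Fsep [phi [phi_bij phiA]] k.
pose e : finsupp 'cV[int]_D R[i]^o := fsingle k (1 : R[i]^o).
(* Injectivity of [phi] forbids [phi e = 0]; any [l] in the support of [phi e] will do. *)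
have [l xil] : exists l, (phi e : finsupp _ _) l != 0.
  apply/not_existsP => phi0.
  have /(congr1 (fun x : finsupp _ _ => x k)) : e = 0.
    apply: (bij_inj phi_bij); rewrite linear0; apply/val_inj/funext => l.
    by have /negP/negPn/eqP := phi0 l.
  by rewrite /= eqxx => /eqP; rewrite oner_eq0.
exists l; apply/eqP; apply: contraPT isT => /eqP neq _.
have /Fsep [f [Ff]] : hbar *: lattice_point A' delta' l <>
    hbar *: lattice_point A delta k.
  by move/(scalerI (lt0r_neq0 hbar_gt0)).
apply.
pose f0 : ssa_type F := SsaElt Ff.
have fe : @shift_act R D hbar theta F Finv A delta (fsingle 0 f0) e =
    f (hbar *: lattice_point A delta k) *: e.
  apply/val_inj/funext => m; rewrite [LHS]shift_act_diag /=.
  rewrite -[RHS]/(_ * (if m == k then 1 else 0)).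
  by have [->|] := eqVneq m k; rewrite ?mulr0.
(* At coordinate [l], both eigenvalues multiply the same nonzero number [phi e l], so they agree,
   against the choice of [f]. *)
have := phiA (fsingle 0 f0) e; rewrite /= fe linearZ.
move=> /(congr1 (fun x : finsupp _ _ => x l)) /esym.
rewrite [LHS]shift_act_diag => /(mulIf xil); exact.
Qed.

Section Reindexing.
Variables (s t : 'cV[int]_D -> 'cV[int]_D) (sK : cancel s t) (tK : cancel t s).

Definition freindex (xi : finsupp 'cV[int]_D R[i]^o) :
  finsupp 'cV[int]_D R[i]^o.
Proof.
apply: (@FinSupp _ _ _ (fun k => xi (s k))).
apply: (@finsupp_fset _ _ _ _ [fset t k | k in supp xi]%fset) => k kn.
apply: supp_out; apply: contra kn => ks.
by rewrite -[k]sK; exact: in_imfset.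
Defined.

End Reindexing.

Lemma lattice_bij_isomorphic A A' (detA : \det A != 0) (detA' : \det A' != 0)
    delta delta' (s t : 'cV[int]_D -> 'cV[int]_D) :
  cancel s t -> cancel t s ->
  (forall k, lattice_point A' delta' k = lattice_point A delta (s k)) ->
  lm_isomorphic (shift_module theta Finv A detA delta)
                (shift_module theta Finv A' detA' delta').
Proof.
move=> sK tK sP.
pose M := shift_module theta Finv A detA delta.
pose N := shift_module theta Finv A' detA' delta'.
(* Both indices have the lattice point of [s k] translated by [vint n], and lattice points determine
   indices. *)
have sD k n : s (k + A' *m n) = s k + A *m n.
  apply: (@lattice_point_inj A delta detA).
  by rewrite -sP !lattice_pointD // sP.
pose phi : M -> N := freindex sK.
have phi_lin : linear phi by move=> a x y; apply/val_inj/funext.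
pose phiL : {linear M -> N} :=
  HB.pack phi (GRing.isLinear.Build _ M N *:%R phi phi_lin).
exists phiL; split.
  by exists (freindex tK) => x; apply/val_inj/funext => k /=;
    rewrite ?sK ?tK.
move=> a x; apply/val_inj/funext => k /=.
rewrite !(shift_actE _ _ _ _ _ _ (@supp_out _ _ _ (a : finsupp _ _))).
by apply: eq_bigr => n _; rewrite sP /= sD.
Qed.

End Action.
End ShiftModules.

Theorem proposition3p10 (R : realType) (D : nat) (D_gt0 : (0 < D)%N)
    (hbar : R) (hbar_gt0 : 0 < hbar)
    (q : R[i]) (q_norm : `|q| = 1) (theta : R) (q_theta : q = expi theta)
    (F : starSubalgebra R D) (Finv : hbar_invariant hbar F)
    (Fsep : separates_points F)
    (A A' : 'M[int]_D) (detA : \det A != 0) (detA' : \det A' != 0)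
    (delta delta' : 'cV[R]_D) :
  lm_isomorphic (shift_module theta Finv A detA delta)
                (shift_module theta Finv A' detA' delta')
  <-> exists (U : 'M[int]_D) (n : 'cV[int]_D),
        [/\ U \in unitmx,
            A' = U *m A &
            delta' = delta + invmx (rmx A) *m vint n].
Proof.
split=> [iso|[U [n [Uu AE deltaE]]]].
  have sub := isomorphic_lattice_sub hbar_gt0 Fsep iso.
  have sub' := isomorphic_lattice_sub hbar_gt0 Fsep
    (lm_isomorphic_sym iso).
  have [U UE] := lattice_sub_factor detA' detA sub.
  have [V VE] := lattice_sub_factor detA detA' sub'.
  (* The lattice point of [A'] at [0] is [delta'] itself, so its index in the other lattice is the
     required [n]. *)
  have [n nE] := sub' 0.
  exists U, n; split=> //; last by rewrite addrC -[LHS](lattice_point0 A') -nE.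
  (* From [A' = U V A'], cancelling the nonzero [\det A'] leaves [\det U * \det V = 1]. *)
  rewrite unitmxE; apply/unitrPr; exists (\det V); apply: (mulIf detA').
  by rewrite mul1r -mulrA -!det_mulmx -VE -UE.
(* Since [A'^-1 k + delta' = A^-1 (U^-1 k + n) + delta], the matching index is [U^-1 k + n]. *)
apply: (@lattice_bij_isomorphic _ _ _ _ _ _ _ _ _ _ _ _
  (fun k => invmx U *m k + n) (fun k => U *m (k - n))).
- by move=> k; rewrite addrK mulKVmx.
- by move=> k; rewrite mulKmx // subrK.
move=> k; rewrite /lattice_point deltaE vintD mulmxDr.
have AU : rmx A' = rmx U *m rmx A :> 'M[R]_D by rewrite AE /rmx map_mxM.
have -> : invmx (rmx A') *m vint k =
    invmx (rmx A) *m vint (invmx U *m k) :> 'cV[R]_D.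
  apply: (can_inj (mulKmx (rmx_unit R detA'))).
  rewrite mulKVmx ?rmx_unit // AU -mulmxA mulKVmx ?rmx_unit //.
  rewrite /vint map_mxM -/(vint k) mulmxA.
  by rewrite /rmx -map_mxM mulmxV // map_mx1 mul1mx.
by rewrite -addrA [delta + _]addrC.
Qed.
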